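(* For every $\epsilon>0$ there exists a constant $C_\epsilon>0$, depending only on $\epsilon$, such that the following holds. Let $N$ be a squarefree positive integer, let $\Sigma=\{(t,t^2):t\in\mathbb{Z}/N\mathbb{Z}\}\subset(\mathbb{Z}/N\mathbb{Z})^2$, and let $f:(\mathbb{Z}/N\mathbb{Z})^2\to\mathbb{C}$ be supported in a set $E\subset(\mathbb{Z}/N\mathbb{Z})^2$ (i.e. $f(x)=0$ for $x\notin E$). If $$|E|<\frac14\cdot N^{2-4\epsilon}\cdot\frac{1}{C_\epsilon^4},$$ then $f$ can be recovered from the values $\{\widehat f(m)\}_{m\notin\Sigma}$ by $L^1$-minimization: $$f=\operatorname*{argmin}_{u:\ \widehat{u}(m)=\widehat{f}(m)\text{ for all } m\notin\Sigma}\|u\|_1,$$ that is, $f$ is the unique minimizer of $\|u\|_1$ among all functions $u:(\mathbb{Z}/N\mathbb{Z})^2\to\mathbb{C}$ satisfying $\widehat{u}(m)=\widehat{f}(m)$ for all $m\in(\mathbb{Z}/N\mathbb{Z})^2\setminus\Sigma$.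
   Context: The Fourier transform of $f:(\mathbb{Z}/N\mathbb{Z})^2\to\mathbb{C}$ is normalized by $\widehat{f}(m)=N^{-1}\sum_{x\in(\mathbb{Z}/N\mathbb{Z})^2}f(x)e^{-2\pi i x\cdot m/N}$ for $m\in(\mathbb{Z}/N\mathbb{Z})^2$, where $x\cdot m=x_1m_1+x_2m_2$. The norm is $\|u\|_1=\sum_{x\in(\mathbb{Z}/N\mathbb{Z})^2}|u(x)|$. *)

(* Defs.v *)
From mathcomp Require Import all_boot all_order all_algebra.
From mathcomp Require Import complex.
From mathcomp Require Import all_classical all_reals all_analysis.

Set Implicit Arguments.
Unset Strict Implicit.
Unset Printing Implicit Defensive.

Import Order.TTheory GRing.Theory Num.Theory.

Local Open Scope ring_scope.
Local Open Scope complex_scope.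

Definition squarefree (n : nat) : Prop :=
  (0 < n)%N /\ forall p : nat, prime p -> ~~ (p ^ 2 %| n)%N.

(* Z/NZ is represented by its residues 'I_N for every N > 0.  The library's
   'Z_N is not used because 'Z_1 denotes Z/2Z, and N = 1 is squarefree. *)
Definition sq_mod (N : nat) (t : 'I_N) : 'I_N :=
  Ordinal (ltn_pmod (t ^ 2) (leq_ltn_trans (leq0n t) (ltn_ord t))).

Definition parabola (N : nat) : {set 'I_N * 'I_N} :=
  [set (t, sq_mod t) | t : 'I_N].

(* The dot product is computed on representatives: its class modulo N, hence
   the character value exp(- 2 pi i x.m / N), does not depend on them. *)
Definition dotI (N : nat) (x m : 'I_N * 'I_N) : nat :=
  (x.1 * m.1 + x.2 * m.2)%N.

Section Fourier.
Variables (R : realType) (N : nat).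

Definition expi (theta : R) : R[i] := cos theta +i* sin theta.

Definition fourier (f : {ffun 'I_N * 'I_N -> R[i]}) (m : 'I_N * 'I_N) : R[i] :=
  N%:R^-1 * \sum_x f x * expi (- 2 * pi * (dotI x m)%:R / N%:R).

Definition norm1 (u : {ffun 'I_N * 'I_N -> R[i]}) : R :=
  \sum_x ComplexField.Normc.normc (u x).

End Fourier.

Definition is_argmin (R : realType) (T : Type) (D : T -> Prop) (J : T -> R)
    (u : T) : Prop :=
  D u /\ forall v, D v -> J u <= J v.

(* Main.v *)
(** Let h = u - f for a competitor u <> f, so that the Fourier transform of h
    lives on the parabola, and let K be 2 to the number of primes dividing N.
    Modulo an odd prime the pair (t1 + t2, t1^2 + t2^2) determines {t1, t2}, so
    by the Chinese remainder theorem it has at most K preimages modulo N.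
    Expanding |h|^4 and using Plancherel twice gives
    N^2 |h|_4^4 <= K |h|_2^4; with Hoelder, |h|_2^3 <= |h|_1 |h|_4^2, this
    becomes N^2 |h|_2^2 <= K |h|_1^2, and Cauchy-Schwarz bounds the mass of h
    on E by sqrt(|E| K) |h|_1 / N.  This is less than |h|_1 / 2 when
    4 |E| K < N^2, which forces |f|_1 < |u|_1.  Finally K <= C^4 N^(4 eps),
    since only the boundedly many primes p with p^(4 eps) < 2 contribute a
    factor exceeding p^(4 eps). *)

Require Import Defs.
From mathcomp Require Import all_boot all_order all_algebra.
From mathcomp Require Import complex.
From mathcomp Require Import all_classical all_reals all_analysis.
From mathcomp Require Import ring lra.

Set Implicit Arguments.
Unset Strict Implicit.
Unset Printing Implicit Defensive.

Import Order.TTheory GRing.Theory Num.Theory.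

Local Open Scope ring_scope.
Local Open Scope complex_scope.

(** * Prescribed sum and sum of squares modulo a squarefree number *)

Lemma squarefree_dvdn (N m : nat) : squarefree N ->
  (forall p, p \in primes N -> (p %| m)%N) -> (N %| m)%N.
Proof.
move=> [N0 sqN] pm; apply/(dvdn_partP _ N0) => p /[!inE] pN.
rewrite p_part; apply: dvdn_trans (pm p pN).
move: pN; rewrite mem_primes => /and3P[pp _ _].
rewrite -[X in (_ %| X)%N]expn1 dvdn_exp2l// leqNgt.
by apply: contra (sqN p pp) => h; rewrite pfactor_dvdn.
Qed.

Lemma eqn_mod_dvdz (d m n : nat) :
  (m == n %[mod d])%N = (d %| m%:Z - n%:Z)%Z.
Proof. by rewrite -eqz_mod_dvd !modz_nat eqz_nat. Qed.

Lemma sum_sumsq_mod_prime (p s1 s2 t1 t2 : nat) : prime p -> odd p ->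
  (t1 + t2 = s1 + s2 %[mod p])%N -> (t1 ^ 2 + t2 ^ 2 = s1 ^ 2 + s2 ^ 2 %[mod p])%N ->
  (t1 == s1 %[mod p])%N || (t1 == s2 %[mod p])%N.
Proof.
move=> pp op /eqP e1 /eqP e2; move: e1 e2; rewrite !eqn_mod_dvdz.
move=> /dvdzP[k1 e1] /dvdzP[k2 e2].
(* [t1] is a root of [2 (X - s1) (X - s2)], a polynomial whose coefficients
   modulo [p] only depend on the sum and the sum of squares of its roots. *)
have : (p%:Z %| 2 * (t1%:Z - s1%:Z) * (t1%:Z - s2%:Z))%Z.
  apply/dvdzP; exists (k2 + k1 * (t1%:Z - t2%:Z - (s1%:Z + s2%:Z))).
  rewrite (mulrDl k2) [k1 * _ * _]mulrAC -e1 -e2 !PoszD -!mulnn !PoszM; ring.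
rewrite !dvdzE !abszM/= !Euclid_dvdM// => /orP[/orP[|->//]|->]; last by rewrite orbT.
by rewrite dvdn_prime2// => /eqP p2; rewrite p2 in op.
Qed.

Lemma card_sum_sumsq_fiber (N : nat) (a b : nat) : squarefree N ->
  (#|[set t : 'I_N * 'I_N | (t.1 + t.2 == a %[mod N]) && (t.1 ^ 2 + t.2 ^ 2 == b %[mod N])]|
     <= 2 ^ size (primes N))%N.
Proof.
move=> sqN; set A := [set _ | _].
have [->|[s sA]] := set_0Vmem A; first by rewrite cards0.
(* Relative to a fixed solution [s], a solution [t] is encoded by the set of
   primes [p] dividing [N] such that [t.1] and [s.1] agree modulo [p]. *)
pose F (t : 'I_N * 'I_N) : (size (primes N)).-tuple bool :=
  map_tuple (fun p => t.1 == s.1 %[mod p])%N (in_tuple (primes N)).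
rewrite -card_bool -card_tuple -(card_in_imset (f := F)) ?max_card// => t u tA uA Ftu.
have modA x y p : x \in A -> y \in A -> (p %| N)%N ->
    (x.1 + x.2 = y.1 + y.2 %[mod p])%N /\ (x.1 ^ 2 + x.2 ^ 2 = y.1 ^ 2 + y.2 ^ 2 %[mod p])%N.
  rewrite !inE => /andP[/eqP x1 /eqP x2] /andP[/eqP y1 /eqP y2] pN.
  by split; rewrite -(modn_dvdm _ pN) ?x1 ?x2 -?y1 -?y2 modn_dvdm.
have eqI (i j : 'I_N) : (i = j %[mod N])%N -> i = j.
  by rewrite !modn_small// => /val_inj.
(* Injectivity of [F]: as [N] is squarefree, it is enough to compare [t.1] and [u.1] modulo each
   prime divisor of [N]. *)
have tu1 : t.1 = u.1.
  apply: eqI; apply/eqP; rewrite eqn_mod_dvdz dvdzE/=.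
  apply: squarefree_dvdn => // p pN.
  have := pN; rewrite mem_primes => /and3P[pp _ pdN].
  have : (t.1 == s.1 %[mod p])%N = (u.1 == s.1 %[mod p])%N.
    by have /(congr1 val)/= /eq_in_map/(_ p pN) := Ftu.
  rewrite -[(p %| _)%N]/(p%:Z %| t.1%:Z - u.1%:Z)%Z -eqn_mod_dvdz.
  have [op|/negbTE] := boolP (odd p); last first.
    (* Modulo 2 there are only two classes, so agreement or disagreement with [s.1] already
       determines the class. *)
    case/even_prime: (pp) => [->|->//] _; rewrite !modn2.
    by do 3!case: (odd _).
  have [t1 t2] := modA _ _ _ tA sA pdN; have [u1 u2] := modA _ _ _ uA sA pdN.
  have /orP := sum_sumsq_mod_prime pp op t1 t2.
  have /orP := sum_sumsq_mod_prime pp op u1 u2.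
  (* For odd [p], an entry that disagrees with [s.1] must agree with [s.2]. *)
  case: eqP => [-> _|_ [//|/eqP->]]; first by case: eqP => // ->.
  by case: eqP => // _ [//|].
have tu2 : t.2 = u.2.
  have [/eqP+ _] := modA _ _ _ tA uA (dvdnn N).
  by rewrite tu1 eqn_modDl => /eqP/eqI.
by case: t u tu1 tu2 {tA uA Ftu} => [? ?] [? ?] /= -> ->.
Qed.

(** * Cauchy-Schwarz and Fourier analysis with a primitive root of unity *)

Lemma sum_CauchySchwarz (F : numDomainType) (I : finType) (P : pred I) (a b : I -> F) :
  (forall i, 0 <= a i) -> (forall i, 0 <= b i) ->
  (\sum_(i | P i) a i * b i) ^+ 2 <=
    (\sum_(i | P i) a i ^+ 2) * (\sum_(i | P i) b i ^+ 2).
Proof.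
move=> a0 b0; rewrite -subr_ge0 -(pmulrn_lge0 _ (ltn0Sn 1)).
(* Lagrange's identity. The entries are nonnegative, hence real, so the squares are nonnegative even
   when [F] is a complex field. *)
suff -> : ((\sum_(i | P i) a i ^+ 2) * (\sum_(i | P i) b i ^+ 2)
    - (\sum_(i | P i) a i * b i) ^+ 2) *+ 2 =
  \sum_(i | P i) \sum_(j | P j) (a i * b j - a j * b i) ^+ 2.
  apply: sumr_ge0 => i _; apply: sumr_ge0 => j _.
  by apply: real_exprn_even_ge0; rewrite ?rpredB// ger0_real ?mulr_ge0.
have E (c d : I -> F) : (\sum_(i | P i) c i) * (\sum_(i | P i) d i) =
    \sum_(i | P i) \sum_(j | P j) c i * d j.
  by rewrite mulr_suml; apply: eq_bigr => i _; rewrite mulr_sumr.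
rewrite mulrnBl mulr2n {1}mulrC expr2 !E -sumrMnl -big_split -sumrB/=.
apply: eq_bigr => i _; rewrite -sumrMnl -big_split -sumrB/=.
apply: eq_bigr => j _; ring.
Qed.

Lemma prim_root_orthogonality (F : fieldType) (N : nat) (w : F) (a b : 'I_N) :
  N.-primitive_root w ->
  \sum_(k < N) w ^+ (a * k) * w^-1 ^+ (b * k) = if a == b then N%:R else 0.
Proof.
move=> wN; have w0 : w != 0.
  apply/eqP => w0; have /eqP := prim_expr_order wN.
  by rewrite w0 expr0n gtn_eqF ?(prim_order_gt0 wN)// eq_sym oner_eq0.
have -> : \sum_(k < N) w ^+ (a * k) * w^-1 ^+ (b * k) = \sum_(k < N) (w ^+ a * w^-1 ^+ b) ^+ k.
  by apply: eq_bigr => k _; rewrite !exprM exprMn.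
case: eqP => [->|/eqP ab].
  under eq_bigr do rewrite -exprMn divff// !expr1n.
  by rewrite sumr_const card_ord.
(* A geometric sum: its product with [z - 1] is [z ^+ N - 1 = 0], and [z = 1] would force
   [a = b]. *)
have /eqP : (w ^+ a * w^-1 ^+ b - 1) * \sum_(k < N) (w ^+ a * w^-1 ^+ b) ^+ k = 0.
  rewrite -subrX1 exprMn -!exprM ![(_ * N)%N]mulnC !exprM exprVn (prim_expr_order wN).
  by rewrite invr1 !expr1n mulr1 subrr.
rewrite mulf_eq0 subr_eq0 exprVn => /orP[|/eqP//].
move=> /eqP/divr1_eq/eqP.
rewrite (eq_prim_root_expr wN) !modn_small// => /eqP/val_inj/eqP.
by rewrite (negbTE ab).
Qed.

Lemma prim_root_orthogonality2 (F : fieldType) (N : nat) (w : F) (x y : 'I_N * 'I_N) :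
  N.-primitive_root w ->
  \sum_m w ^+ dotI x m * w^-1 ^+ dotI y m = if x == y then N%:R ^+ 2 else 0.
Proof.
move=> wN; have -> : \sum_m w ^+ dotI x m * w^-1 ^+ dotI y m =
    \sum_(i < N) \sum_(j < N) (w ^+ (x.1 * i) * w^-1 ^+ (y.1 * i)) *
                            (w ^+ (x.2 * j) * w^-1 ^+ (y.2 * j)).
  rewrite pair_bigA; apply: eq_bigr => m _.
  by rewrite /dotI !exprD mulrACA.
under eq_bigr do rewrite -mulr_sumr.
rewrite -mulr_suml !prim_root_orthogonality//.
case: x y => [x1 x2] [y1 y2]; rewrite xpair_eqE/=.
by case: eqP; case: eqP; rewrite ?mulr0 ?mul0r.
Qed.

Lemma conj_prim_root (C : numClosedFieldType) (N : nat) (w : C) :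
  N.-primitive_root w -> Num.conj w = w^-1.
Proof.
move=> wN; have w1 : `|w| = 1.
  have /eqP := congr1 Num.norm (prim_expr_order wN).
  rewrite normrX normr1 pexprn_eq1// (gtn_eqF (prim_order_gt0 wN)) => /eqP//.
by rewrite invC_norm w1 expr1n invr1 mul1r.
Qed.

(** Expand the square and sum over [m] first: orthogonality leaves the diagonal, with weight [N ^ 2]
    because the transform here is unnormalized. Since [w] is any primitive root, the inverse root is
    covered as well. *)
Lemma fourier_Plancherel (C : numClosedFieldType) (N : nat) (w : C)
    (h : 'I_N * 'I_N -> C) : N.-primitive_root w ->
  \sum_m `|\sum_x h x * w ^+ dotI x m| ^+ 2 = N%:R ^+ 2 * \sum_x `|h x| ^+ 2.
Proof.
move=> wN.
have -> : \sum_m `|\sum_x h x * w ^+ dotI x m| ^+ 2 =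
    \sum_m \sum_x \sum_y h x * Num.conj (h y) * (w ^+ dotI x m * w^-1 ^+ dotI y m).
  apply: eq_bigr => m _; rewrite normCK rmorph_sum mulr_suml; apply: eq_bigr => x _.
  rewrite mulr_sumr; apply: eq_bigr => y _.
  by rewrite rmorphM rmorphXn/= (conj_prim_root wN) mulrACA.
rewrite exchange_big mulr_sumr; apply: eq_bigr => x _ /=.
rewrite exchange_big (bigD1 x)//= -mulr_sumr prim_root_orthogonality2// eqxx.
rewrite big1 ?addr0 -?normCK 1?mulrC// => y yx.
by rewrite -mulr_sumr prim_root_orthogonality2// eq_sym (negbTE yx) mulr0.
Qed.

Lemma fourier_inversion (F : fieldType) (N : nat) (w : F)
    (h : 'I_N * 'I_N -> F) (y : 'I_N * 'I_N) : N.-primitive_root w ->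
  \sum_m (\sum_x h x * w ^+ dotI x m) * w^-1 ^+ dotI y m = N%:R ^+ 2 * h y.
Proof.
move=> wN.
have -> : \sum_m (\sum_x h x * w ^+ dotI x m) * w^-1 ^+ dotI y m =
    \sum_x h x * \sum_m w ^+ dotI x m * w^-1 ^+ dotI y m.
  under eq_bigr do rewrite mulr_suml.
  rewrite exchange_big; apply: eq_bigr => x _; rewrite mulr_sumr.
  by apply: eq_bigr => m _; rewrite mulrA.
rewrite (bigD1 y)//= prim_root_orthogonality2// eqxx big1 ?addr0 1?mulrC// => x xy.
by rewrite prim_root_orthogonality2// (negbTE xy) mulr0.
Qed.

(** * The L^4 bound on the parabola and the spread of L^1 mass *)

Lemma sqr_norm_sum_le (C : numDomainType) (I : finType) (P : {pred I}) (z : I -> C) :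
  `|\sum_(i in P) z i| ^+ 2 <= #|P|%:R * \sum_(i in P) `|z i| ^+ 2.
Proof.
apply: le_trans (_ : (\sum_(i in P) `|z i|) ^+ 2 <= _).
  by rewrite lerXn2r ?nnegrE ?sumr_ge0// ler_norm_sum.
have -> : \sum_(i in P) `|z i| = \sum_(i in P) 1 * `|z i|.
  by apply: eq_bigr => i _; rewrite mul1r.
apply: le_trans (sum_CauchySchwarz _ _ _) _ => //.
by under eq_bigr do rewrite expr1n; rewrite sumr_const.
Qed.

(** The square of the inner sum is again a Fourier sum, whose coefficient [G c] collects the pairs
    with sum and sum of squares given by [c]. Plancherel reduces the L^4 norm to the L^2 norm of
    [G], and Cauchy-Schwarz on each fibre of [b] costs the size of the fibre. *)
Lemma parabola_L4 (C : numClosedFieldType) (N : nat) (w : C) (g : 'I_N -> C) :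
  squarefree N -> N.-primitive_root w ->
  \sum_x `|\sum_t g t * w ^+ dotI x (t, sq_mod t)| ^+ 4 <=
    N%:R ^+ 2 * (2 ^ size (primes N))%:R * (\sum_t `|g t| ^+ 2) ^+ 2.
Proof.
move=> sqN wN; have N0 : (0 < N)%N by case: sqN.
pose b (p : 'I_N * 'I_N) : 'I_N * 'I_N :=
  (Ordinal (ltn_pmod (p.1 + p.2) N0), Ordinal (ltn_pmod (p.1 ^ 2 + p.2 ^ 2) N0)).
pose G c := \sum_(p | b p == c) g p.1 * g p.2.
have GE x : (\sum_t g t * w ^+ dotI x (t, sq_mod t)) ^+ 2 = \sum_c G c * w ^+ dotI c x.
  rewrite expr2 mulr_suml.
  under eq_bigr do rewrite mulr_sumr.
  rewrite pair_bigA (partition_big b xpredT)//=; apply: eq_bigr => c _.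
  rewrite mulr_suml; apply: eq_bigr => p /eqP <-.
  rewrite mulrACA -exprD; congr (_ * _); apply/eqP.
  (* Exponents of [w] matter only modulo [N], so the reductions inside [sq_mod] and [b] can be
     undone. *)
  rewrite (eq_prim_root_expr wN) /dotI/= addnACA -!mulnDr ![(_ %% N * _)%N]mulnC.
  rewrite -modnDm -(modnMmr x.2) modnDm modnDm.
  by rewrite -[in eqbLHS]modnDm -(modnMmr x.1) modnDm.
have -> : \sum_x `|\sum_t g t * w ^+ dotI x (t, sq_mod t)| ^+ 4 =
    \sum_x `|\sum_c G c * w ^+ dotI c x| ^+ 2.
  by apply: eq_bigr => x _; rewrite -GE normrX -exprM.
rewrite fourier_Plancherel// -mulrA ler_wpM2l ?exprn_ge0//.
have -> : (\sum_t `|g t| ^+ 2) ^+ 2 = \sum_c \sum_(p | b p == c) `|g p.1 * g p.2| ^+ 2.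
  rewrite expr2 mulr_suml.
  under eq_bigr do rewrite mulr_sumr.
  rewrite pair_bigA (partition_big b xpredT)//=; apply: eq_bigr => c _.
  by apply: eq_bigr => p _; rewrite normrM exprMn.
rewrite mulr_sumr; apply: ler_sum => c _.
apply: le_trans (sqr_norm_sum_le _ _) _.
apply: ler_wpM2r; first by apply: sumr_ge0 => p _; rewrite exprn_ge0.
rewrite ler_nat; apply: leq_trans (card_sum_sumsq_fiber c.1 c.2 sqN).
apply: subset_leq_card; apply/fintype.subsetP => p.
rewrite inE -[p \in _]/(b p == c) => /eqP <- /=.
by rewrite !modn_mod !eqxx.
Qed.

Lemma sum_Holder_124 (F : numFieldType) (I : finType) (a : I -> F) :
  (forall i, 0 <= a i) ->
  (\sum_i a i ^+ 2) ^+ 3 <= (\sum_i a i) ^+ 2 * \sum_i a i ^+ 4.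
Proof.
move=> a0; set S2 := \sum_i a i ^+ 2; set S1 := \sum_i a i; set S4 := \sum_i _.
pose S3 := \sum_i a i ^+ 3.
have S_ge0 n : 0 <= \sum_i a i ^+ n by apply: sumr_ge0 => i _; rewrite exprn_ge0.
have S1_ge0 : 0 <= S1 by apply: sumr_ge0.
have [s0|s0] := eqVneq S2 0.
  by rewrite s0 expr0n/= mulr_ge0 ?exprn_ge0// S_ge0.
have S2_gt0 : 0 < S2 by rewrite lt0r s0 S_ge0.
(* Cauchy-Schwarz for [sqrt a] and [sqrt (a^3)], avoiding the square roots:
   [0 <= \sum a (S1 a - S2)^2] expands to [0 <= S1 (S1 S3 - S2^2)]. *)
have h1 : S2 ^+ 2 <= S1 * S3.
  have [s1|s1] := eqVneq S1 0.
    have a_0 i : a i = 0.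
      by apply: (psumr_eq0P (P := xpredT)) => //; rewrite -[RHS]s1.
    by move: s0; rewrite /S2 big1 ?eqxx// => i _; rewrite a_0 expr0n.
  have S1_gt0 : 0 < S1 by rewrite lt0r s1.
  have : 0 <= \sum_i a i * (S1 * a i - S2) ^+ 2.
    apply: sumr_ge0 => i _; rewrite mulr_ge0// real_exprn_even_ge0//.
    by rewrite rpredB// ger0_real ?mulr_ge0// S_ge0.
  have E (s t : F) : \sum_i a i * (s * a i - t) ^+ 2 =
      s ^+ 2 * S3 - (2 * s * t) * S2 + t ^+ 2 * S1.
    rewrite /S3 /S2 /S1 !mulr_sumr -sumrB -big_split/=.
    by apply: eq_bigr => i _; ring.
  have -> : \sum_i a i * (S1 * a i - S2) ^+ 2 = S1 * (S1 * S3 - S2 ^+ 2).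
    by rewrite E; ring.
  by rewrite pmulr_rge0// subr_ge0.
have h2 : S3 ^+ 2 <= S2 * S4.
  have := sum_CauchySchwarz xpredT a0 (fun i => exprn_ge0 2 (a0 i)).
  have -> : \sum_i a i * a i ^+ 2 = S3 by apply: eq_bigr => i _; rewrite -exprS.
  by have -> : \sum_i (a i ^+ 2) ^+ 2 = S4 by apply: eq_bigr => i _; rewrite -exprM.
(* After multiplication by [S2], the chain is [S2^4 <= (S1 S3)^2 <= S1^2 (S2 S4)]. *)
rewrite -(ler_pM2l S2_gt0) -exprS.
apply: le_trans (_ : (S1 * S3) ^+ 2 <= _).
  rewrite -[S2 ^+ 4]/(S2 ^+ (2 * 2)) exprM.
  by rewrite lerXn2r// nnegrE ?exprn_ge0 ?mulr_ge0// ?S_ge0.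
by rewrite exprMn [leRHS]mulrCA ler_wpM2l// exprn_ge0.
Qed.

Lemma L1_concentration (C : numClosedFieldType) (N : nat) (w : C)
    (E : {set 'I_N * 'I_N}) (h : 'I_N * 'I_N -> C) :
  squarefree N -> N.-primitive_root w ->
  (forall m, m \notin parabola N -> \sum_x h x * w ^+ dotI x m = 0) ->
  (4 * #|E| * 2 ^ size (primes N) < N ^ 2)%N ->
  (exists x, h x != 0) ->
  2 * \sum_(x in E) `|h x| < \sum_x `|h x|.
Proof.
move=> sqN wN h0 EN [x0 hx0]; have N0 : (0 < N)%N by case: sqN.
have wVN : N.-primitive_root w^-1 by rewrite -(conj_prim_root wN) fmorph_primitive_root.
pose K : C := (2 ^ size (primes N))%:R.
have K_ge0 : 0 <= K by rewrite ler0n.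
have n_gt0 : 0 < N%:R :> C by rewrite ltr0n.
pose S n := \sum_x `|h x| ^+ n.
have S_gt0 n : 0 < S n.
  rewrite /S (bigD1 x0)//= ltr_wpDr ?exprn_gt0 ?normr_gt0//.
  by apply: sumr_ge0 => *; rewrite exprn_ge0.
pose g t := \sum_x h x * w ^+ dotI x (t, sq_mod t).
have sumP (F : 'I_N * 'I_N -> C) : (forall m, m \notin parabola N -> F m = 0) ->
    \sum_m F m = \sum_t F (t, sq_mod t).
  move=> F0; rewrite (bigID (mem (parabola N)))/= [X in _ + X]big1// addr0.
  by rewrite big_imset//= => t u _ _ [].
have gS : \sum_t `|g t| ^+ 2 = N%:R ^+ 2 * S 2.
  rewrite -(fourier_Plancherel h wN) sumP// => m mP.
  by rewrite h0// normr0 expr0n.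
(* Inversion writes [h], up to [N ^ 2], as a sum over the parabola with the inverse root, which is
   the form [parabola_L4] bounds. *)
have hE y : N%:R ^+ 2 * h y = \sum_t g t * w^-1 ^+ dotI y (t, sq_mod t).
  by rewrite -(fourier_inversion h y wN) sumP// => m mP; rewrite h0// mul0r.
have L4 : N%:R ^+ 2 * S 4 <= K * S 2 ^+ 2.
  have := parabola_L4 g sqN wVN; rewrite gS -/K.
  under eq_bigr do rewrite -hE normrM exprMn.
  rewrite -mulr_sumr -/(S 4) ger0_norm ?exprn_ge0// => le4.
  (* The bound [le4] amounts to [N^8 S4 <= N^6 K S2^2]. *)
  rewrite -(ler_pM2l (exprn_gt0 6 n_gt0)); move: le4; congr (_ <= _); ring.
have L2 : N%:R ^+ 2 * S 2 <= K * S 1 ^+ 2.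
  rewrite -(ler_pM2r (exprn_gt0 2 (S_gt0 2))).
  apply: le_trans (_ : S 1 ^+ 2 * (N%:R ^+ 2 * S 4) <= _).
    rewrite [leRHS]mulrCA -[leLHS]mulrA -exprS ler_wpM2l ?exprn_ge0//.
    exact: (sum_Holder_124 (a := fun x => `|h x|)).
  by rewrite [leRHS]mulrAC [leRHS]mulrC ler_wpM2l// exprn_ge0// ltW.
have LE : (\sum_(x in E) `|h x|) ^+ 2 <= #|E|%:R * S 2.
  have := sqr_norm_sum_le E (fun x => `|h x|).
  rewrite ger0_norm ?sumr_ge0// => /le_trans; apply.
  rewrite ler_wpM2l// /S [leRHS](bigID (mem E))/= ler_wpDr//.
    by apply: sumr_ge0 => *; rewrite exprn_ge0.
  by under eq_bigr do rewrite normr_id.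
have S1_ge0 := ltW (S_gt0 1).
(* Square and multiply by [N^2]: with [M] the mass on [E], [4 N^2 M^2 <= 4 |E| N^2 S2 <= 4 |E| K
   S1^2 < N^2 S1^2]. *)
rewrite -[ltRHS]/(S 1) -(ltr_pXn2r (n := 2))// ?nnegrE ?mulr_ge0 ?sumr_ge0//.
rewrite -(ltr_pM2l (exprn_gt0 2 n_gt0)).
apply: le_lt_trans (_ : (4 * #|E| * 2 ^ size (primes N))%:R * S 1 ^+ 2 < _); last first.
  by rewrite -natrX ltr_pM2r ?exprn_gt0// ltr_nat.
rewrite exprMn mulrCA (_ : 2 ^+ 2 = 4%:R); last by rewrite -natrX.
rewrite !natrM -/K -[leRHS]mulrA -[leRHS]mulrA.
rewrite ler_wpM2l//.
apply: le_trans (_ : #|E|%:R * (N%:R ^+ 2 * S 2) <= _); last by rewrite ler_wpM2l.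
by rewrite [leRHS]mulrCA ler_wpM2l// exprn_ge0// ltW.
Qed.

(** * Two to the number of prime divisors against small powers of N *)

Lemma prod_primes_le (N : nat) : (0 < N)%N -> (\prod_(p <- primes N) p <= N)%N.
Proof.
move=> N0; rewrite [leqRHS](prod_prime_decomp N0) /primes /unzip1 big_map.
rewrite big_seq [leqRHS]big_seq; apply: leq_prod => -[p e].
move=> /mem_prime_decomp[pp e0 _] /=.
by rewrite -[leqLHS]expn1 leq_pexp2l// prime_gt0.
Qed.

(** An entry [p >= B] satisfies [2 <= p^d] and pays for its own factor 2; the factors 2 of the
    smaller entries are kept in the count. *)
Lemma exp2_size_le (R : realType) (d : R) (B : nat) (s : seq nat) : 0 < d ->
  2 `^ d^-1 <= B%:R -> all (fun p => 0 < p)%N s ->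
  2 ^+ size s <= 2 ^+ count (fun p => p < B)%N s * (\prod_(p <- s) p)%:R `^ d :> R.
Proof.
move=> d0 hB; elim: s => [|p s IHs] /=.
  by rewrite big_nil powR1 mulr1.
move=> /andP[p0 /IHs{}IHs]; rewrite big_cons natrM powRM// exprS exprD mulrACA.
apply: ler_pM; rewrite ?exprn_ge0//.
case: ltnP => pB /=.
  rewrite expr1 ler_peMr//.
  by rewrite -[leLHS](powRr0 p%:R) ler_powR ?ler1n// ltW.
have -> : 2 = (2 `^ d^-1) `^ d :> R.
  by rewrite -powRrM mulVf ?gt_eqF// powRr1.
rewrite expr0 mul1r.
rewrite ge0_ler_powR ?nnegrE ?powR_ge0 ?(ltW d0)//.
by apply: le_trans hB _; rewrite ler_nat.
Qed.

Lemma exp2_primes_le (R : realType) (d : R) : 0 < d ->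
  exists B : nat, forall N, (0 < N)%N ->
    2 ^+ size (primes N) <= 2 ^+ B * N%:R `^ d :> R.
Proof.
move=> d0; exists (Num.bound (2 `^ d^-1 : R)) => N N0.
set B := Num.bound _.
have hB : 2 `^ d^-1 <= B%:R :> R by rewrite ltW// archi_boundP// powR_ge0.
apply: le_trans (exp2_size_le d0 hB _) _.
  by apply/allP => p /[!mem_primes] /andP[/prime_gt0].
apply: ler_pM; rewrite ?exprn_ge0 ?powR_ge0//.
  (* The primes are distinct, so at most [B] of them lie below [B]. *)
  rewrite ler_eXn2l ?ltr1n// -size_filter -[leqRHS](size_iota 0).
  apply: uniq_leq_size; first by rewrite filter_uniq ?primes_uniq.
  by move=> p; rewrite mem_filter mem_iota add0n => /andP[].
by rewrite ge0_ler_powR ?nnegrE ?(ltW d0)// ler_nat prod_primes_le.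
Qed.

(** * The complex exponential as a primitive root of unity *)

Lemma expiD (R : realType) (a b : R) : expi (a + b) = expi a * expi b.
Proof. by rewrite /expi cosD sinD; apply/eqP; rewrite eq_complex/= eqxx addrC eqxx. Qed.

Lemma expi_natr (R : realType) (a : R) (n : nat) : expi (a * n%:R) = expi a ^+ n.
Proof.
elim: n => [|n IHn]; first by rewrite mulr0 expr0 /expi cos0 sin0.
by rewrite -natr1 mulrDr mulr1 expiD IHn exprSr.
Qed.

Lemma expi_prim_root (R : realType) (N : nat) : (0 < N)%N ->
  N.-primitive_root (expi (- 2 * pi / N%:R) : R[i]).
Proof.
move=> N0; set w := expi _.
have NR0 : 0 < N%:R :> R by rewrite ltr0n.
have wN : w ^+ N = 1.
  rewrite -expi_natr divfK ?gt_eqF// mulNr mulr_natl /expi cosN sinN cos2pi sin2pi.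
  by rewrite oppr0.
have [m wm mN] := prim_order_exists N0 wN.
have m0 := prim_order_gt0 wm.
have := dvdn_leq N0 mN; rewrite leq_eqVlt => /orP[/eqP<-//|mltN].
have /(congr1 (@complex.Re R))/= : expi (- 2 * pi / N%:R * m%:R) = 1 :> R[i].
  by rewrite expi_natr (prim_expr_order wm).
(* Half the angle of a supposed smaller order [m]. The real part gives [1 - 2 sin(t)^2 = 1], but
   [sin t > 0] on the open interval from 0 to [pi]. *)
pose t : R := pi * (m%:R / N%:R).
have -> : - 2 * pi / N%:R * m%:R = - (t *+ 2) :> R by rewrite /t mulr2n; ring.
have t0 : 0 < t < pi.
  rewrite /t mulr_gt0 ?pi_gt0 ?divr_gt0 ?ltr0n//=.
  by rewrite gtr_pMr ?pi_gt0// ltr_pdivrMr// mul1r ltr_nat.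
rewrite cosN cos_mulr2n cos2sin2 => h.
have : sin t ^+ 2 = 0 by lra.
by move/eqP; rewrite expf_eq0/= gt_eqF// sin_gt0_pi.
Qed.

(** * Recovery by L^1-minimization *)

Lemma l1_null_space_property (F : numDomainType) (T : finType) (E : {set T})
    (f v : T -> F) : (forall x, x \notin E -> f x = 0) ->
  2 * \sum_(x in E) `|v x - f x| < \sum_x `|v x - f x| ->
  \sum_x `|f x| < \sum_x `|v x|.
Proof.
move=> f0; rewrite [ltRHS](bigID (mem E))/= mulr_natl mulr2n ltrD2l => hE.
rewrite (bigID (mem E))/= [X in _ + X]big1 ?addr0; last first.
  by move=> x xE; rewrite f0// normr0.
rewrite [ltRHS](bigID (mem E))/=.
(* On [E] the triangle inequality costs the mass of [v - f] there; by [hE] this is less than its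
   mass off [E], where [v - f] is [v]. *)
apply: le_lt_trans (_ : \sum_(x in E) `|v x| + \sum_(x in E) `|v x - f x| < _).
  rewrite -big_split/=; apply: ler_sum => x _.
  by rewrite -[X in `|X| <= _](subKr (v x)) ler_normB.
rewrite ltrD2l; apply: lt_le_trans hE _; apply: ler_sum => x xE.
by rewrite f0// subr0.
Qed.

Lemma fourierE (R : realType) (N : nat) (f : {ffun 'I_N * 'I_N -> R[i]}) m :
  fourier f m = N%:R^-1 * \sum_x f x * expi (- 2 * pi / N%:R) ^+ dotI x m.
Proof.
rewrite /fourier; congr (_ * _); apply: eq_bigr => x _.
by rewrite -expi_natr mulrAC.
Qed.

Lemma norm1E (R : realType) (N : nat) (u : {ffun 'I_N * 'I_N -> R[i]}) :
  (norm1 u)%:C = \sum_x `|u x|.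
Proof. by rewrite /norm1 rmorph_sum. Qed.

Lemma norm1_lt (R : realType) (N : nat) (E : {set 'I_N * 'I_N})
    (f v : {ffun 'I_N * 'I_N -> R[i]}) :
  squarefree N -> (forall x, x \notin E -> f x = 0) ->
  (4 * #|E| * 2 ^ size (primes N) < N ^ 2)%N ->
  (forall m, m \notin parabola N -> fourier v m = fourier f m) ->
  v != f -> norm1 f < norm1 v.
Proof.
move=> sqN f0 EN vf nvf; have N0 : (0 < N)%N by case: sqN.
rewrite -ltcR !norm1E; apply: (l1_null_space_property f0).
apply: (L1_concentration (h := fun x => v x - f x) sqN (expi_prim_root R N0)) => //.
  move=> m /vf; rewrite !fourierE => /mulfI e.
  under eq_bigr do rewrite mulrBl.
  by rewrite sumrB e ?subrr// invr_eq0 pnatr_eq0 -lt0n.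
have [/forallP vfE|] := boolP [forall x, v x == f x].
  by case/eqP: nvf; apply/ffunP => x; exact/eqP.
by rewrite negb_forall => /existsP[x vfx]; exists x; rewrite subr_eq0.
Qed.

Theorem theorem1p6 (R : realType) (eps : R) (heps : 0 < eps) :
  exists C : R, 0 < C /\
    forall (N : nat) (E : {set 'I_N * 'I_N}) (f : {ffun 'I_N * 'I_N -> R[i]}),
      squarefree N ->
      (forall x, x \notin E -> f x = 0) ->
      #|E|%:R < 1 / 4 * (N%:R `^ (2 - 4 * eps)) * (1 / C ^+ 4) ->
      unique
        (is_argmin
           (fun u : {ffun 'I_N * 'I_N -> R[i]} =>
              forall m, m \notin parabola N -> fourier u m = fourier f m)
           (@norm1 R N))
        f.
Proof.
have eps4 : 0 < 4 * eps by rewrite mulr_gt0.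
have [B hB] := exp2_primes_le eps4.
have C_gt0 : 0 < 2 ^+ B :> R by rewrite exprn_gt0.
(* [B] comes from the exponent [4 * eps]; as [C >= 1], the bound [C * N^(4 eps)] may be raised to
   [C^4 * N^(4 eps)], matching the hypothesis on [E]. *)
exists (2 ^+ B); split => // N E f sqN f0 hE.
have N0 : (0 < N)%N by case: sqN.
have NR0 : 0 < N%:R :> R by rewrite ltr0n.
have EN : (4 * #|E| * 2 ^ size (primes N) < N ^ 2)%N.
  rewrite -(ltr_nat R) [ltRHS]natrX !natrM natrX.
  have -> : N%:R ^+ 2 = N%:R `^ (2 - 4 * eps) * N%:R `^ (4 * eps) :> R.
    by rewrite -powRD ?subrK ?powR_mulrn ?(ltW NR0)// gt_eqF ?implybT.
  apply: le_lt_trans (_ : 4 * #|E|%:R * (2 ^+ B) ^+ 4 * N%:R `^ (4 * eps) < _).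
    rewrite -[leRHS]mulrA; apply: ler_wpM2l; first by rewrite mulr_ge0.
    apply: le_trans (hB N N0) _; rewrite ler_wpM2r ?powR_ge0//.
    by rewrite ler_eXnr// exprn_ege1// ler1n.
  rewrite ltr_pM2r ?powR_gt0// -ltr_pdivlMr ?exprn_gt0//.
  rewrite mulrC -ltr_pdivlMr//; apply: lt_le_trans hE _.
  by rewrite div1r; lra.
(* The strict inequality gives both minimality of [f] and uniqueness. *)
have lt_norm := norm1_lt sqN f0 EN.
split; first split => // v Dv.
  by have [->//|nvf] := eqVneq v f; exact/ltW/lt_norm.
move=> v [Dv vmin]; apply/eqP; rewrite eq_sym; apply: contraT => nvf.
by have := lt_norm v Dv nvf; rewrite ltNge vmin.
Qed.
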